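(* Let $X$ be a closed linear subspace of $(BC(\mathbb{R}),\|\cdot\|_\infty)$ such that for every $\lambda>0$ one has $T(f,g)\in X$ for all $f\in X$ and all $g\in X$ with $g(t)\ge \lambda$ for all $t\in\mathbb{R}$. Let $F,G:(X,\|\cdot\|_\infty)\to(X,\|\cdot\|_\infty)$ be continuous maps, and write $F(x,t):=F(x)(t)$, $G(x,t):=G(x)(t)$. Assume: (a) $l:=\inf_{x\in X,\,t\in\mathbb{R}}G(x,t)>0$, and there are real numbers $k\le M$ such that $F$ and $G$ are bounded on $B_{[k,M]}$ (i.e. $\sup_{x\in B_{[k,M]}}\|F(x)\|_\infty<\infty$ and $\sup_{x\in B_{[k,M]}}\|G(x)\|_\infty<\infty$) and $k\le \frac{F(x,t)}{G(x,t)}\le M$ for all $(x,t)\in B_{[k,M]}\times\mathbb{R}$; (b) for every sequence $(x_n)\subset X$ converging uniformly on each compact subset of $\mathbb{R}$ to some element of $BC(\mathbb{R})$, the sequences $(F(x_n))$ and $(G(x_n))$ are relatively compact in $(X,\|\cdot\|_\infty)$; (c) there exist $L_F,L_G\ge 0$ such that $|F(x,t)-F(y,t)|\le L_F|x(t)-y(t)|$ and $|G(x,t)-G(y,t)|\le L_G|x(t)-y(t)|$ for all $x,y\in X$ and $t\in\mathbb{R}$; (d) $l> L_G\max(M,-k)+L_F$. Then the equation $$x'(t)+G(x,t)\,x(t)=F(x,t),\qquad \forall t\in\mathbb{R},$$ has at least one solution $x^*\in X$ which is globally attractive.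
   Context: $BC(\mathbb{R})$ is the Banach space of bounded continuous functions $\mathbb{R}\to\mathbb{R}$ with the sup-norm $\|\cdot\|_\infty$. For $f,g\in BC(\mathbb{R})$ with $\inf_{t\in\mathbb{R}} g(t)>0$, $T(f,g)\in BC(\mathbb{R})$ denotes the function $T(f,g)(t)=\int_{-\infty}^t e^{-\int_s^t g(u)\,du}f(s)\,ds$. For real $k\le M$, $B_{[k,M]}:=\{x\in X:\ x(t)\in[k,M]\ \forall t\in\mathbb{R}\}$. A solution of the equation is a differentiable function $x\in X$ satisfying it at every $t\in\mathbb{R}$. A solution $x^*$ is globally attractive if for any other solution $x$ (in $X$) of the equation, $\lim_{t\to+\infty}|x(t)-x^*(t)|=0$. *)

(* Defs.v *)
From HB Require Import structures.
From mathcomp Require Import all_boot all_order all_algebra.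
From mathcomp Require Import all_classical all_reals all_analysis.
From mathcomp Require Import ring.

Set Implicit Arguments.
Unset Strict Implicit.
Unset Printing Implicit Defensive.

Import Order.TTheory GRing.Theory Num.Theory.
Import numFieldNormedType.Exports.

Local Open Scope classical_set_scope.
Local Open Scope ring_scope.

Section BoundedContinuous.
Context {R : realType}.

Definition bcfun : {pred R -> R} :=
  [pred f | `[< continuous f /\ [bounded f t | t in setT] >]].

Lemma bcfunP (f : R -> R) :
  reflect (continuous f /\ [bounded f t | t in setT]) (f \in bcfun).
Proof. exact: asboolP. Qed.

Lemma bounded_setTP (f : R -> R) :
  [bounded f t | t in setT] <-> exists C, forall t, `|f t| <= C.
Proof.
have PF : ProperFilter (globally [set: R]) := globally_properfilter (I : setT 0).
rewrite ex_bound; split=> -[C fC]; exists C => t; last by move=> _; exact: fC.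
exact: (fC t I).
Qed.

Lemma bcfun_submod_closed : GRing.submod_closed bcfun.
Proof.
split=> [|a f g /bcfunP[cf bf] /bcfunP[cg bg]]; apply/bcfunP.
  split; first by move=> t; exact: cvg_cst.
  by apply/bounded_setTP; exists 0 => t /=; rewrite normr0.
split; first by move=> t; apply: cvgD; [apply: cvgZr; exact: cf|exact: cg].
move/bounded_setTP : bf => [Cf bf]; move/bounded_setTP : bg => [Cg bg].
apply/bounded_setTP; exists (`|a| * Cf + Cg) => t /=.
rewrite (le_trans (ler_normD _ _))// lerD//.
by rewrite normrM ler_wpM2l.
Qed.

HB.instance Definition _ :=
  GRing.isSubmodClosed.Build _ _ bcfun bcfun_submod_closed.

End BoundedContinuous.

Record BC (R : realType) := MkBC {
  BC_fun :> R -> R ;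
  BC_funP : BC_fun \in bcfun }.

Section BCBanach.
Context {R : realType}.

HB.instance Definition _ := [isSub for @BC_fun R].
HB.instance Definition _ := [Choice of BC R by <:].
HB.instance Definition _ := [SubChoice_isSubLmodule of BC R by <:].

Definition supnorm (f : BC R) : R := sup [set `|f t| | t in setT].

Lemma BC_continuous (f : BC R) : continuous f.
Proof. by have /bcfunP[] := BC_funP f. Qed.

Lemma BC_bounded (f : BC R) : [bounded f t | t in setT].
Proof. by have /bcfunP[] := BC_funP f. Qed.

Lemma BC_eq (f g : BC R) : f =1 g -> f = g.
Proof. by move=> fg; apply/val_inj/funext. Qed.

Lemma supnorm_has_sup (f : BC R) : has_sup [set `|f t| | t in setT].
Proof.
split; first by exists `|f 0|, 0.
have /bounded_setTP[C fC] := BC_bounded f.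
by exists C => _ [t _ <-].
Qed.

Lemma supnorm_ub (f : BC R) (t : R) : `|f t| <= supnorm f.
Proof. by apply: ub_le_sup; [case: (supnorm_has_sup f)|exists t]. Qed.

Lemma supnorm_le (f : BC R) (C : R) :
  (forall t, `|f t| <= C) -> supnorm f <= C.
Proof.
move=> fC; apply: ge_sup; first by case: (supnorm_has_sup f).
by move=> _ [t _ <-].
Qed.

Lemma supnormD (f g : BC R) : supnorm (f + g) <= supnorm f + supnorm g.
Proof.
apply: supnorm_le => t.
by rewrite (le_trans (ler_normD _ _))// lerD// supnorm_ub.
Qed.

Lemma supnormZ (a : R) (f : BC R) : supnorm (a *: f) = `|a| * supnorm f.
Proof.
have le b h : supnorm (b *: h) <= `|b| * supnorm h.
  by apply: supnorm_le => t; rewrite normrM ler_wpM2l// supnorm_ub.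
apply/eqP; rewrite eq_le le/=.
have [->|a0] := eqVneq a 0.
  by rewrite normr0 mul0r (le_trans _ (supnorm_ub _ 0)).
rewrite -ler_pdivlMl ?normr_gt0// -normfV.
by rewrite -{1}(scalerK a0 f).
Qed.

Lemma supnorm0_eq0 (f : BC R) : supnorm f = 0 -> f = 0.
Proof.
move=> f0; apply: BC_eq => t; apply/eqP.
by rewrite -normr_le0 -f0 supnorm_ub.
Qed.

HB.instance Definition _ :=
  Lmodule_isNormed.Build R (BC R) supnormD supnormZ supnorm0_eq0.

Lemma BC_norm_ub (f : BC R) (t : R) : `|f t| <= `|f|.
Proof. exact: supnorm_ub. Qed.

Lemma BC_norm_le (f : BC R) (C : R) : (forall t, `|f t| <= C) -> `|f| <= C.
Proof. exact: supnorm_le. Qed.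

Lemma BC_complete (F : set_system (BC R)) {FF : ProperFilter F} :
  cauchy F -> cvg F.
Proof.
move=> /cauchy_ballP Fc.
have Fce (e : R) : 0 < e -> \forall f & g \near F, `|f - g| < e.
  by move=> e0; have := Fc _ e0; rewrite -ball_normE.
pose l (t : R) : R := lim ((fun f : BC R => f t) @ F).
have Fl t : (fun f : BC R => f t) @ F --> l t.
  apply/cauchy_cvgP/cauchy_ballP => e e0; rewrite near_map2.
  apply: filterS (Fce _ e0) => -[f g] /= fg.
  rewrite -ball_normE/=.
  exact: le_lt_trans (BC_norm_ub (f - g) t) fg.
have unifl (e : R) : 0 < e -> \forall f \near F, forall t, `|(f : BC R) t - l t| <= e.
  move=> e0; have e20 : 0 < e / 2 by rewrite divr_gt0.
  near=> f => t; near F => g.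
  rewrite [leRHS]splitr.
  have -> : f t - l t = (f - g) t + (g t - l t) by rewrite /= addrA subrK.
  rewrite (le_trans (ler_normD _ _))// lerD//.
    rewrite (le_trans (BC_norm_ub _ _))// ltW//.
    by near: g; near: f; apply: nearP_dep; exact: Fce.
  rewrite distrC ltW//; near: g.
  by have /cvgrPdist_lt := Fl t; exact.
have lBC : l \in bcfun.
  apply/bcfunP; split.
    move=> t; apply/cvgrPdist_le => e e0.
    have e30 : 0 < e / 3 by rewrite divr_gt0.
    near F => f.
    have fl : forall s, `|f s - l s| <= e / 3 by near: f; exact: unifl.
    have /cvgrPdist_le/(_ _ e30) := @BC_continuous f t.
    apply: filterS => s fts.
    have -> : l t - l s = - (f t - l t) + (f t - f s) + (f s - l s) by ring.
    have -> : e = e / 3 + e / 3 + e / 3 by field.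
    by rewrite (le_trans (ler_normD _ _))// lerD// (le_trans (ler_normD _ _))//
      lerD// normrN.
  near F => f.
  have fl : forall s, `|f s - l s| <= 1 by near: f; exact: unifl.
  apply/bounded_setTP; exists (`|f| + 1) => t.
  have -> : l t = f t - (f t - l t) by rewrite opprB addrC subrK.
  by rewrite (le_trans (ler_normB _ _))// lerD// BC_norm_ub.
apply/cvg_ex; exists (MkBC lBC); apply/cvgrPdist_le => e e0.
apply: filterS (unifl _ e0) => f fl.
by apply: BC_norm_le => t /=; rewrite distrC; exact: fl.
Unshelve. all: by end_near. Qed.

HB.instance Definition _ := Uniform_isComplete.Build (BC R) BC_complete.

End BCBanach.

Section Equation.
Context {R : realType}.
Implicit Types (f g x y : BC R) (X : set (BC R)) (F G : BC R -> BC R).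

(* A bare function, since it need not be in BC R without a positive lower bound
   on g; "Tint f g belongs to X" is therefore stated below as the existence of an
   element of X whose underlying function is Tint f g. *)
Definition Tint f g : R -> R := fun t =>
  \int[lebesgue_measure]_(s in `]-oo, t])
    (expR (- \int[lebesgue_measure]_(u in `[s, t]) g u) * f s).

Definition T_stable X := forall lambda : R, 0 < lambda ->
  forall f g, X f -> X g -> (forall t, lambda <= g t) ->
  exists2 h, X h & (h : R -> R) = Tint f g.

Definition Bset X (k M : R) : set (BC R) :=
  [set x | X x /\ forall t, x t \in `[k, M]].

(* When X is nonempty, a positive value really is the infimum: [inf] is 0 on sets
   that are not bounded from below. *)
Definition infval X G : R := inf [set G x t | x in X & t in [set: R]].

(* Uniform convergence on compact sets is the topology of the function space,
   whereas precompactness is relative to the sup-norm topology of BC R. *)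
Definition compact_cvg_precompact X F :=
  forall x_ : nat -> BC R, (forall n, X (x_ n)) ->
  forall y, {family compact, (fun n => x_ n : R -> R) @ \oo --> (y : R -> R)} ->
  precompact (range (F \o x_)).

Definition pointwise_lipschitz X F (L : R) :=
  forall x y, X x -> X y -> forall t, `|F x t - F y t| <= L * `|x t - y t|.

Definition is_solution X F G x :=
  X x /\ forall t, derivable (x : R -> R) t 1 /\
                   derive1 (x : R -> R) t + G x t * x t = F x t.

Definition globally_attractive X F G (xs : BC R) :=
  forall x, is_solution X F G x -> `|x t - xs t| @[t --> +oo] --> (0 : R).

End Equation.

(* Main.v *)
(* By (c), F(x,t) and G(x,t) depend on x only through x(t), and the map
   x |-> T(F(x),G(x)) is a contraction of B_[k,M]. Indeed u = T(f,g) is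
   the bounded solution of u' + g u = f, and an integrating factor shows that
   |f| <= c g forces |u| <= c, and likewise k g <= f <= M g forces k <= u <= M.
   If u and v are the images of x and y, then w = u - v satisfies
   w' + G(x) w = F(x) - F(y) - (G(x) - G(y)) v, whose right-hand side is at most
   (L_F + L_G max(M,-k)) |x - y|; hence the Lipschitz constant is
   (L_F + L_G max(M,-k)) / l < 1. The same identity applied to the fixed point
   and any other solution gives an exponentially decaying difference. *)

Require Import Defs.
From HB Require Import structures.
From mathcomp Require Import all_boot all_order all_algebra.
From mathcomp Require Import all_classical all_reals all_analysis.
From mathcomp Require Import measurable_realfun ring lra.

Set Implicit Arguments.
Unset Strict Implicit.
Unset Printing Implicit Defensive.

Import Order.TTheory GRing.Theory Num.Theory.
Import numFieldNormedType.Exports.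

Local Open Scope classical_set_scope.
Local Open Scope ring_scope.

(** * Primitives and improper integrals of continuous functions *)

Section Primitive.
Context {R : realType}.
Implicit Types (f g : R -> R) (a b c t : R).
Local Notation mu := (@lebesgue_measure R).

Lemma is_derive_continuous f (df : R -> R) :
  (forall t, is_derive t 1 f (df t)) -> continuous f.
Proof.
by move=> fdf t; apply: differentiable_continuous; apply/derivable1_diffP.
Qed.

Lemma is_derive_le0_nonincreasing f (df : R -> R) :
  (forall t, is_derive t 1 f (df t)) -> (forall t, df t <= 0) ->
  {homo f : s t /~ s <= t}.
Proof.
move=> fdf df0 t s st; have [//|c _ ftsE] := MVT_segment st (fun x _ => fdf x).
  by apply: continuous_subspaceT; exact: is_derive_continuous fdf.
by rewrite -subr_le0 ftsE mulr_le0_ge0// subr_ge0.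
Qed.

Lemma continuous_itv_integrable f a b : continuous f ->
  mu.-integrable `[a, b] (EFin \o f).
Proof.
move=> cf; apply: continuous_compact_integrable; first exact: segment_compact.
exact: continuous_subspaceT.
Qed.

Lemma is_derive_Rintegral f a t : continuous f -> a < t ->
  is_derive t 1 (fun x => \int[mu]_(s in `[a, x]) f s) (f t).
Proof.
move=> cf at_; have [] := @continuous_FTC1_closed R f a t (t + 1) _ _ at_ (cf t).
- by rewrite ltrDl.
- exact: continuous_itv_integrable.
by move=> d e; apply: DeriveDef; [exact: d|rewrite -derive1E; exact: e].
Qed.

(** The integral over [[0, t]] vanishes for [t < 0] and the one over [[t, 0]] for [t > 0], so their
    difference is the oriented integral from 0 to [t]. *)
Lemma continuous_primitive f : continuous f ->
  exists P : R -> R, forall t, is_derive t 1 P (f t).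
Proof.
move=> cf.
exists (fun t => \int[mu]_(s in `[0, t]) f s - \int[mu]_(s in `[t, 0]) f s) => t.
(* With a base point below both [t] and 0, the oriented integral agrees near [t] with [Q], an
   ordinary integral from [a] up to a constant. *)
pose a := Num.min t 0 - 1.
have at_ : a < t by rewrite /a ltrBlDr (@le_lt_trans _ _ t)// ?ge_min ?lexx// ltrDl.
have a0 : a < 0 by rewrite /a subr_lt0 (@le_lt_trans _ _ 0)// ge_min lexx orbT.
pose Q x := \int[mu]_(s in `[a, x]) f s - \int[mu]_(s in `[a, 0]) f s.
have dQ : is_derive t 1 Q (f t).
  rewrite -[f t]subr0; apply: is_deriveB; exact: is_derive_Rintegral.
have split_int x y : a <= x -> x <= y ->
    \int[mu]_(s in `[a, y]) f s - \int[mu]_(s in `[a, x]) f s =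
    \int[mu]_(s in `[x, y]) f s.
  move=> ax xy; rewrite Rintegral_itvB ?bnd_simp//; last first.
    exact: continuous_itv_integrable.
  rewrite Rintegral_itv_obnd_cbnd//.
  apply: integrableS (continuous_itv_integrable x y cf) => //.
  by apply: subset_itvr; rewrite bnd_simp.
apply: near_eq_is_derive dQ.
near=> x.
have ax : a <= x by apply: ltW; near: x; exact: lt_nbhsr.
rewrite /Q /=; have [x0|x0] := leP 0 x.
  rewrite split_int ?(ltW a0)//; move: x0; rewrite le_eqVlt => /predU1P[<-|x0].
    by rewrite !set_itv1 Rintegral_set1 subrr.
  by rewrite [in X in _ - X]set_itv_ge ?Rintegral_set0 ?subr0// -leNgt bnd_simp.
rewrite (@set_itv_ge _ _ (BLeft 0) (BRight x)) ?Rintegral_set0 ?sub0r; last first.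
  by rewrite -leNgt bnd_simp.
by rewrite -(split_int _ _ ax (ltW x0)) opprB.
Unshelve. all: by end_near. Qed.

Lemma Rintegral_primitive f P a b : continuous f ->
  (forall t, is_derive t 1 P (f t)) -> a <= b ->
  \int[mu]_(s in `[a, b]) f s = P b - P a.
Proof.
move=> cf Pf; rewrite le_eqVlt => /predU1P[<-|ab].
  by rewrite set_itv1 Rintegral_set1 subrr.
have cP := is_derive_continuous Pf.
rewrite /Rintegral (@continuous_FTC2 _ f P)//.
- exact: continuous_subspaceT.
- split; first by move=> x _; exact: ex_derive.
  + by apply: cvg_at_right_filter; exact: cP.
  + by apply: cvg_at_left_filter; exact: cP.
- by move=> x _; rewrite derive1E; exact: derive_val.
Qed.

(** Monotone convergence along the segments [[b - n, b]], which exhaust the half-line. *)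
Lemma integrableNy_ge0 f b c : continuous f -> (forall t, 0 <= f t) ->
  (forall a, a <= b -> \int[mu]_(s in `[a, b]) f s <= c) ->
  mu.-integrable `]-oo, b] (EFin \o f).
Proof.
move=> cf f0 fc; apply/integrableP; split.
  by apply/measurable_EFinP/measurable_funTS; exact: continuous_measurable_fun.
under eq_integral do rewrite /= ger0_norm//.
rewrite itvNy_bnd_bigcup_BLeft.
apply: (@le_lt_trans _ _ c%:E); last exact: ltry.
pose I n := `[b - n%:R, b]%classic.
have Icvg : (\int[mu]_(x in I n) (f x)%:E)%E @[n --> \oo] -->
    (\int[mu]_(x in \bigcup_n I n) (f x)%:E)%E.
  apply: ge0_nondecreasing_set_cvg_integral => //.
  - move=> m n mn; apply/subsetPset; apply: subset_itvr.
    by rewrite bnd_simp lerD2l lerN2 ler_nat.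
  - by move=> n; exact: measurable_itv.
  - move=> n; apply/measurable_EFinP/measurable_funTS.
    exact: continuous_measurable_fun.
  - by move=> n x _; rewrite lee_fin.
apply: cvge_le Icvg; apply: nearW => n.
have fi := continuous_itv_integrable (b - n%:R) b cf.
rewrite -(fineK (integrable_fin_num _ fi))// lee_fin; apply: fc.
by rewrite lerBlDr lerDl.
Qed.

End Primitive.

(** * The linear equation h' + g h = f and comparison with constants *)

Section LinearODE.
Context {R : realType}.
Local Notation mu := (@lebesgue_measure R).

Lemma is_derive_expR_comp (P : R -> R) (p t : R) : is_derive t 1 P p ->
  is_derive t 1 (expR \o P) (expR (P t) * p).
Proof. by move=> dP; apply: is_derive1_comp. Qed.

(** For a primitive [P] of [g] the kernel splits as exp(-P(t)) exp(P(s)). Hence [Tint f g] is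
    exp(-P) times the integral [H] of exp(P) f, and the product rule applies. *)
Lemma is_derive_Tint (f g : BC R) (lambda : R) : 0 < lambda ->
  (forall t, lambda <= g t) ->
  forall t : R, is_derive t 1 (Tint f g) (f t - g t * Tint f g t).
Proof.
move=> lambda0 glambda t.
have cf := @BC_continuous _ f; have cg := @BC_continuous _ g.
have [P dP] := continuous_primitive cg.
have cP := is_derive_continuous dP.
have ceP : continuous (expR \o P).
  by move=> x; apply: continuous_comp; [exact: cP|exact: continuous_expR].
pose H x := \int[mu]_(s in `]-oo, x]) (expR (P s) * f s).
have g0 x : 0 <= g x by rewrite (le_trans (ltW lambda0)).
(* exp(P) g is the derivative of exp(P), so its integrals over segments ending at [b] are at most
   exp(P(b)). *)
have intg b : mu.-integrable `]-oo, b] (EFin \o (fun s => expR (P s) * g s)).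
  have cgP : continuous (fun s => expR (P s) * g s).
    by move=> x; apply: cvgM; [exact: ceP|exact: cg].
  apply: (@integrableNy_ge0 _ _ _ (expR (P b))) => //.
    by move=> x; rewrite mulr_ge0// expR_ge0.
  move=> a ab; rewrite (Rintegral_primitive (P := expR \o P) cgP _ ab).
  by rewrite gerBl// expR_ge0.
(* Domination by the previous integrand: [lambda <= g] gives |f(s)| <= (|f| / lambda) g(s), with |f|
   the sup-norm. *)
have intf b : mu.-integrable `]-oo, b] (EFin \o (fun s => expR (P s) * f s)).
  have : mu.-integrable `]-oo, b]
      (fun s => (`|f| / lambda)%:E * (expR (P s) * g s)%:E)%E.
    by apply: integrableZl => //; exact: intg.
  apply: le_integrable => //.
    apply/measurable_EFinP/measurable_funTS; apply: continuous_measurable_fun.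
    by move=> x; apply: cvgM; [exact: ceP|exact: cf].
  move=> x _; rewrite -EFinM /= lee_fin !normrM (ger0_norm (expR_ge0 _)).
  rewrite mulrCA ler_wpM2l ?expR_ge0// normr_id normfV (ger0_norm (g0 x)).
  rewrite (gtr0_norm lambda0) -mulrA.
  rewrite (le_trans (BC_norm_ub f x))// ler_peMr// ler_pdivlMl// mulr1.
  exact: glambda.
have TE : Tint f g = (fun x => expR (- P x) * H x).
  apply/funext => x; rewrite /H -RintegralZl//.
  apply: eq_Rintegral => s; rewrite inE/= in_itv/= => sx.
  by rewrite (Rintegral_primitive cg dP sx) opprB expRD mulrCA mulrA.
have dH : is_derive t 1 H (expR (P t) * f t).
  have ct : {for t, continuous (fun s => expR (P s) * f s)}.
    by apply: cvgM; [exact: ceP|exact: cf].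
  have tt1 : t < t + 1 by rewrite ltrDl.
  have Nyt : (-oo%O < BRight t)%E by rewrite ltNyr.
  have [] := continuous_FTC1 tt1 (intf _) Nyt ct.
  by move=> d e; apply: DeriveDef; [exact: d|rewrite -derive1E; exact: e].
have dNP : is_derive t 1 (expR \o (- P)) (expR (- P t) * - g t).
  exact: is_derive_expR_comp.
have := @is_deriveM _ _ _ _ _ _ _ _ dNP dH.
rewrite TE => dT; apply: is_derive_eq.
transitivity (expR (- P t) * (expR (P t) * f t) + H t * (expR (- P t) * - g t)).
  by [].
by rewrite mulrA -expRD addNr expR0; ring.
Qed.

(* If y t > 0, the integrating factor shows that y grows exponentially backwards
   from t, against the bound on y. *)
Lemma bounded_subsolution_le0 (y dy g : R -> R) (lambda c : R) :
  continuous g -> 0 < lambda -> (forall t, lambda <= g t) ->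
  (forall t : R, is_derive t 1 y (dy t)) -> (forall t, dy t + g t * y t <= 0) ->
  (forall t, y t <= c) -> forall t, y t <= 0.
Proof.
move=> cg lambda0 glambda ydy yle yc t; rewrite leNgt; apply/negP => yt0.
have [P dP] := continuous_primitive cg.
have mono : {homo (fun s => y s * expR (P s)) : s t /~ s <= t}.
  pose dz s := y s * (expR (P s) * g s) + expR (P s) * dy s.
  apply: (@is_derive_le0_nonincreasing _ _ dz) => s.
    exact: (@is_deriveM _ _ _ _ _ _ _ _ (ydy s) (is_derive_expR_comp (dP s))).
  have -> : dz s = expR (P s) * (dy s + g s * y s) by rewrite /dz; ring.
  by rewrite mulr_ge0_le0 ?expR_ge0.
have Plip : {homo (fun s => lambda * s - P s) : s t /~ s <= t}.
  apply: (@is_derive_le0_nonincreasing _ _ (fun s => lambda - g s)) => s.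
    have dZ : is_derive s 1 ( *%R lambda) lambda.
      by rewrite -[X in is_derive _ _ _ X]mulr1; exact: (@is_deriveZ _ _ _ id).
    exact: (@is_deriveB _ _ _ _ _ _ _ _ _ dZ (dP s)).
  by rewrite subr_le0.
have c0 : 0 < c := lt_le_trans yt0 (yc t).
(* Chosen so that [y t * (lambda * d) = c]: going back by [d], the bound 1 + u <= exp(u) already
   gives y(t - d) >= y(t) + c > c. *)
pose d := c / (lambda * y t).
have d0 : 0 < d by rewrite divr_gt0// mulr_gt0.
have std : t - d <= t by rewrite gerBl ltW.
have /= := mono _ _ std; have /= := Plip _ _ std.
move=> Pd yd; have yd' : y t * expR (P t - P (t - d)) <= y (t - d).
  by rewrite expRB mulrA ler_pdivrMr ?expR_gt0.
have ld : lambda * d <= P t - P (t - d) by lra.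
have : y t * (1 + lambda * d) <= c.
  apply: le_trans (yc (t - d)); apply: le_trans yd'.
  by rewrite ler_pM2l// (le_trans (expR_ge1Dx _))// ler_expR.
have -> : y t * (1 + lambda * d) = y t + c.
  by rewrite /d; field; rewrite !gt_eqF.
by rewrite gerDr leNgt yt0.
Qed.

Definition linear_solution (f g h : R -> R) :=
  forall t : R, is_derive t 1 h (f t - g t * h t).

(** The shift [h - c] is bounded above and satisfies (h - c)' + g (h - c) = f - c g <= 0. *)
Lemma linear_solution_le (f g : R -> R) (h : BC R) (lambda c : R) :
  continuous g -> 0 < lambda -> (forall t, lambda <= g t) ->
  linear_solution f g h -> (forall t, f t <= c * g t) -> forall t, h t <= c.
Proof.
move=> cg lambda0 glambda hsol fc t; rewrite -subr_le0.
apply: (@bounded_subsolution_le0 (fun s => h s - c) (fun s => f s - g s * h s)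
  g lambda (`|h| - c)) => //.
- by move=> s; rewrite -[f s - _]subr0; exact: is_deriveB.
- by move=> s; have := fc s; lra.
- by move=> s; rewrite lerD2r (le_trans (ler_norm _))// BC_norm_ub.
Qed.

Lemma linear_solutionN (f g h : R -> R) :
  linear_solution f g h -> linear_solution (- f) g (- h).
Proof.
move=> hsol t; rewrite (_ : _ - _ = - (f t - g t * h t)).
  exact: is_deriveN.
by rewrite !opprfctE; ring.
Qed.

Lemma linear_solution_ge (f g : R -> R) (h : BC R) (lambda c : R) :
  continuous g -> 0 < lambda -> (forall t, lambda <= g t) ->
  linear_solution f g h -> (forall t, c * g t <= f t) -> forall t, c <= h t.
Proof.
move=> cg lambda0 glambda hsol fc t; rewrite -lerN2.
apply: (@linear_solution_le (- f) g (- h) lambda) => //.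
  exact: (linear_solutionN hsol).
by move=> s; rewrite opprfctE mulNr lerN2.
Qed.

Lemma linear_solution_norm (f g : R -> R) (h : BC R) (lambda c : R) :
  continuous g -> 0 < lambda -> (forall t, lambda <= g t) ->
  linear_solution f g h -> (forall t, `|f t| <= c * g t) -> `|h| <= c.
Proof.
move=> cg lambda0 glambda hsol fc; apply: BC_norm_le => t; rewrite ler_norml.
apply/andP; split.
  apply: (linear_solution_ge cg lambda0 glambda hsol) => s.
  by have := fc s; rewrite ler_norml mulNr => /andP[].
apply: (linear_solution_le cg lambda0 glambda hsol) => s.
by have := fc s; rewrite ler_norml => /andP[].
Qed.

End LinearODE.

(** * Differences of solutions under the Lipschitz conditions *)

Section Perturbation.
Context {R : realType} (X : set (BC R)) (F G : BC R -> BC R) (LF LG : R)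
  (F_lip : pointwise_lipschitz X F LF) (G_lip : pointwise_lipschitz X G LG).

Lemma is_solutionP (x : BC R) :
  is_solution X F G x <-> X x /\ linear_solution (F x) (G x) x.
Proof.
split=> -[Xx xsol]; split=> // t.
  have [dx <-] := xsol t; apply: DeriveDef; first exact: dx.
  by rewrite -derive1E addrK.
have dx := xsol t; split; first exact: ex_derive.
by rewrite derive1E derive_val subrK.
Qed.

Lemma infval_le (x : BC R) (t : R) : 0 < infval X G -> X x ->
  infval X G <= G x t.
Proof.
move=> G0 Xx; apply: ge_inf; last by exists x => //; exists t.
(* Without a genuine infimum [inf] would take its default value 0, against positivity. *)
by have [[]//|/inf_out] := pselect (has_inf [set G x t | x in X & t in [set: R]]);
  rewrite -/(infval X G) => G00; rewrite G00 ltxx in G0.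
Qed.

(* T(g, g) = 1, so a subspace stable under T contains the constants as soon as it
   contains one function that is bounded away from 0. *)
Lemma T_stable_cst (g : BC R) (lambda c : R) : GRing.submod_closed [in X] ->
  T_stable X -> X g -> 0 < lambda -> (forall t, lambda <= g t) ->
  exists2 h : BC R, X h & forall t, h t = c.
Proof.
move=> [X0 XZ] X_T Xg lambda0 glambda.
have [h Xh hT] := X_T _ lambda0 _ _ Xg Xg glambda.
have hsol : linear_solution g g h by rewrite hT; exact: is_derive_Tint glambda.
have cg := @BC_continuous _ g.
have h1 t : h t = 1.
  apply/eqP; rewrite eq_le.
  rewrite (linear_solution_le cg lambda0 glambda hsol); last first.
    by move=> s; rewrite mul1r.
  by rewrite (linear_solution_ge cg lambda0 glambda hsol)// => s; rewrite mul1r.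
exists (c *: h); last by move=> t; rewrite -[RHS]mulr1 -(h1 t).
by have := XZ c h 0; rewrite addr0 !inE; apply=> //; rewrite -in_setE.
Qed.

(** Writing G(x) u - G(y) v = G(x) (u - v) + (G(x) - G(y)) v charges the change of coefficient to
    [v] alone, so only [v] will need an explicit bound. *)
Lemma linear_solutionB (x y : BC R) (u v : BC R) :
  linear_solution (F x) (G x) u -> linear_solution (F y) (G y) v ->
  linear_solution (fun t => F x t - F y t - (G x t - G y t) * v t) (G x) (u - v).
Proof.
move=> usol vsol t; have dB := @is_deriveB _ _ _ _ _ _ _ _ _ (usol t) (vsol t).
apply: (is_derive_eq dB); rewrite (_ : (u - v) t = u t - v t)//; ring.
Qed.

Lemma perturbation_le (x y v : BC R) (m t : R) : X x -> X y -> 0 <= LG ->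
  `|v t| <= m ->
  `|F x t - F y t - (G x t - G y t) * v t| <= (LG * m + LF) * `|x t - y t|.
Proof.
move=> Xx Xy LG0 vm.
rewrite (le_trans (ler_normB _ _))// [leRHS]mulrDl [leRHS]addrC lerD//.
  exact: F_lip.
by rewrite normrM mulrAC ler_pM//; exact: G_lip.
Qed.

(* The square of w = x - y satisfies (w^2)' <= - 2 (lambda - kappa) w^2. *)
Lemma solution_attractive (x y : BC R) (m lambda : R) : 0 <= LG ->
  (forall t, lambda <= G x t) -> LG * m + LF < lambda ->
  is_solution X F G x -> is_solution X F G y -> (forall t, `|y t| <= m) ->
  `|x t - y t| @[t --> +oo] --> (0 : R).
Proof.
move=> LG0 Glambda gap /is_solutionP[Xx xsol] /is_solutionP[Xy ysol] ym.
set kappa := LG * m + LF in gap.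
pose d := lambda - kappa; have d0 : 0 < d by rewrite subr_gt0.
pose w : R -> R := x - y.
pose r t := F x t - F y t - (G x t - G y t) * y t.
have wsol : linear_solution r (G x) w by exact: linear_solutionB xsol ysol.
have rw t : `|r t| <= kappa * `|w t| by exact: perturbation_le.
have dE (t : R) : is_derive t 1 (expR \o ( *%R (2 * d))) (expR (2 * d * t) * (2 * d)).
  apply: is_derive_expR_comp.
  by rewrite -[X in is_derive _ _ _ X]mulr1; exact: (@is_deriveZ _ _ _ id).
(* The square replaces |w|, which need not be differentiable at zeros of [w]. *)
pose z t := w t * w t * expR (2 * d * t).
have zmono : {homo z : s t /~ s <= t}.
  pose dz t := w t * w t * (expR (2 * d * t) * (2 * d)) + expR (2 * d * t) *
    (w t * (r t - G x t * w t) + w t * (r t - G x t * w t)).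
  apply: (@is_derive_le0_nonincreasing _ _ dz) => t.
    have dww := @is_deriveM _ _ _ _ _ _ _ _ (wsol t) (wsol t).
    exact: (@is_deriveM _ _ _ _ _ _ _ _ dww (dE t)).
  (* The last factor is nonpositive: r w <= kappa w^2 by [rw], and [lambda <= G x t]. *)
  have -> : dz t = 2 * expR (2 * d * t) *
      (r t * w t - kappa * (w t * w t) - (G x t - lambda) * (w t * w t)).
    by rewrite /dz /d; ring.
  rewrite mulr_ge0_le0 ?mulr_ge0 ?expR_ge0// subr_le0.
  have ww0 : 0 <= w t * w t by rewrite -expr2 sqr_ge0.
  apply: (@le_trans _ _ 0); last by rewrite mulr_ge0// subr_ge0.
  rewrite subr_le0 (le_trans (ler_norm _))// normrM.
  by rewrite -(ger0_norm ww0) normrM mulrA ler_wpM2r.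
(* Square root of the inequality z(t) <= z(0). *)
have w_le t : 0 <= t -> `|w t| <= `|w 0| * expR (- (d * t)).
  move=> t0; have /= := zmono _ _ t0; rewrite /z mulr0 expR0 mulr1 => zt.
  rewrite -ler_sqr ?nnegrE ?mulr_ge0 ?expR_ge0// exprMn -!normrX.
  rewrite !ger0_norm ?sqr_ge0// !expr2 -expRD.
  rewrite -ler_pdivrMr ?expR_gt0// -expRN.
  by rewrite (le_trans _ zt)// ler_wpM2l ?ler_expR; [|rewrite -expr2 sqr_ge0|lra].
apply: (@squeeze_cvgr _ _ _ _ (cst 0) (fun t => `|w 0| * expR (- (d * t)))).
- near=> t; by rewrite normr_ge0 /= w_le.
- exact: cvg_cst.
- rewrite -[X in _ --> X](mulr0 `|w 0|); apply: cvgMr.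
  apply: (@cvg_comp _ _ _ ( *%R d) (fun t => expR (- t))); last exact: cvgr_expR.
  exact: gt0_cvgMry.
Unshelve. all: by end_near. Qed.

End Perturbation.

(** * Fixed point of the contraction and its attractivity *)

Theorem theorem2 (R : realType) (X : set (BC R))
    (X_linear : GRing.submod_closed [in X])
    (X_closed : closed X)
    (X_T : T_stable X)
    (F G : BC R -> BC R)
    (F_X : forall x, X x -> X (F x))
    (G_X : forall x, X x -> X (G x))
    (F_cont : {within X, continuous F})
    (G_cont : {within X, continuous G})
    (G_inf_gt0 : 0 < infval X G)
    (k M : R) (k_le_M : k <= M)
    (F_bounded : [bounded F x | x in Bset X k M])
    (G_bounded : [bounded G x | x in Bset X k M])
    (FG_range : forall x, Bset X k M x -> forall t, k <= F x t / G x t <= M)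
    (F_compact : compact_cvg_precompact X F)
    (G_compact : compact_cvg_precompact X G)
    (LF LG : R) (LF_ge0 : 0 <= LF) (LG_ge0 : 0 <= LG)
    (F_lip : pointwise_lipschitz X F LF)
    (G_lip : pointwise_lipschitz X G LG)
    (gap : LG * Num.max M (- k) + LF < infval X G) :
  exists2 xs : BC R, is_solution X F G xs & globally_attractive X F G xs.
Proof.
set l := infval X G in G_inf_gt0 gap; set m := Num.max M (- k) in gap.
have Gl x t : X x -> l <= G x t by exact: infval_le.
(* On [X], [Phi x] is T(F(x), G(x)); from here on only its membership in [X] and its linear equation
   are used. *)
have [Phi PhiP] : exists Phi : BC R -> BC R, forall x, X x ->
    X (Phi x) /\ linear_solution (F x) (G x) (Phi x).
  have /choice[Phi PhiP] : forall x, exists h : BC R, X x ->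
      X h /\ linear_solution (F x) (G x) h.
    move=> x; have [Xx|] := pselect (X x); last by exists 0.
    have [h Xh hT] := X_T _ G_inf_gt0 _ _ (F_X _ Xx) (G_X _ Xx)
      (fun t => Gl _ t Xx).
    exists h => _; split=> //; rewrite hT.
    by apply: is_derive_Tint G_inf_gt0 _ => t; exact: Gl.
  by exists Phi.
have Bm x t : Bset X k M x -> `|x t| <= m.
  move=> [_ /(_ t)]; rewrite in_itv/= => /andP[kx xM].
  rewrite ler_norml /m lerNl !le_max; apply/andP; split; apply/orP; [right|left].
    by rewrite lerN2.
  by [].
have PhiB x : Bset X k M x -> Bset X k M (Phi x).
  move=> Bx; have Xx := Bx.1; have [XPhi Phisol] := PhiP _ Xx.
  have cG := @BC_continuous _ (G x).
  have Glx t := Gl x t Xx.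
  have G0 t : 0 < G x t := lt_le_trans G_inf_gt0 (Glx t).
  split=> // t; rewrite in_itv/=; apply/andP; split.
    apply: (linear_solution_ge cG G_inf_gt0 Glx Phisol) => s.
    by have /andP[+ _] := FG_range _ Bx s; rewrite ler_pdivlMr.
  apply: (linear_solution_le cG G_inf_gt0 Glx Phisol) => s.
  by have /andP[_] := FG_range _ Bx s; rewrite ler_pdivrMr.
(* Evaluation at a point is 1-Lipschitz for the sup-norm, so each pointwise constraint is closed. *)
have B_closed : closed (Bset X k M).
  rewrite (_ : Bset X k M = X `&` \bigcap_t [set x : BC R | x t \in `[k, M]]).
    apply: closedI => //; apply: closed_bigI => t _.
    have evt : continuous (fun x : BC R => x t).
      move=> x A /nbhs_ballP[e e0 eA]; apply/nbhs_ballP; exists e => // y xy.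
      apply: eA; move: xy; rewrite -!ball_normE/=; apply: le_lt_trans.
      exact: BC_norm_ub (x - y) t.
    apply: (@closed_comp _ _ (fun x : BC R => x t) [set` `[k, M]]).
      by move=> x _; exact: evt.
    exact: itv_closed.
  apply/seteqP; split=> x [Xx Bx]; first by split=> // t _; exact: Bx.
  by split=> // t; exact: Bx.
(* The constant [k] lies in [X] because [G 0] is bounded away from 0. *)
have B_nonempty : Bset X k M !=set0.
  have X0 : X 0 by have [+ _] := X_linear; rewrite inE.
  have [h Xh hk] := T_stable_cst k X_linear X_T (G_X _ X0) G_inf_gt0
    (fun t => Gl _ t X0).
  by exists h; split=> // t; rewrite hk in_itv/= lexx k_le_M.
pose kappa := LG * m + LF.
have m0 : 0 <= m.
  have [h Bh] := B_nonempty; exact: le_trans (normr_ge0 _) (Bm _ 0 Bh).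
have kappa0 : 0 <= kappa by rewrite addr_ge0// mulr_ge0.
have q0 : 0 <= kappa / l by rewrite divr_ge0// ltW.
have Phi_lip x y : Bset X k M x -> Bset X k M y ->
    `|Phi x - Phi y| <= kappa / l * `|x - y|.
  move=> Bx By; have [Xx Xy] := (Bx.1, By.1).
  have [_ solx] := PhiP _ Xx; have [_ soly] := PhiP _ Xy.
  apply: (linear_solution_norm (@BC_continuous _ (G x)) G_inf_gt0
    (fun t => Gl _ t Xx) (linear_solutionB solx soly)) => t.
  apply: le_trans
    (perturbation_le F_lip G_lip Xx Xy LG_ge0 (Bm _ t (PhiB _ By))) _.
  (* The factor [G x t / l] is at least 1, which is how dividing by [l] enters the contraction
     constant. *)
  rewrite -/kappa (_ : kappa / l * _ * _ = kappa * `|x - y| * (G x t / l)).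
    rewrite (@le_trans _ _ (kappa * `|x - y|))//.
      by rewrite ler_wpM2l//; exact: BC_norm_ub (x - y) t.
    by rewrite ler_peMr ?mulr_ge0// ler_pdivlMr// mul1r Gl.
  by ring.
have [xs Bxs xsE] : exists2 xs, Bset X k M xs & xs = Phi xs.
  pose f := mkfun_fun PhiB.
  have := @banach_fixed_point R (BC R) (Bset X k M) f _ B_closed B_nonempty.
  apply; exists (NngNum q0); split=> [|[x y] [/= Bx By]]; last exact: Phi_lip.
  by rewrite /= ltr_pdivrMr// mul1r.
have xs_sol : is_solution X F G xs.
  apply/is_solutionP; have [_] := PhiP _ Bxs.1; rewrite -xsE; split=> //.
  exact: Bxs.1.
exists xs => // x xsol.
(* Only [xs] must obey the bound [m]; the other solution may take values outside [[k, M]]. *)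
apply: (solution_attractive F_lip G_lip LG_ge0 _ gap xsol xs_sol).
  by move=> t; apply: Gl; case: xsol.
by move=> t; exact: Bm.
Qed.
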